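(* Let $D\in\mathcal E^n$ have embedding dimension $r$. Let $C_k$, for $k\in\mathcal C$, be a given clique with node $l\notin C_k$, and let $\beta:=\{j_1,\dots,j_{r+1}\}\subseteq C_k$ be such that the distances $D_{lj_i}$, for $i=1,\dots,r+1$, are known. If $$\operatorname{rank}\mathcal K^\dagger(D[\beta])=r,$$ then $l$ can be absorbed by the clique $C_k$ and we can complete the missing elements in column (row) $l$ of $D[C_k\cup\{l\}]$.
   Context: A real symmetric $n\times n$ matrix $D$ is a Euclidean distance matrix (EDM) if there are points $p_1,\dots,p_n\in\mathbb R^r$, for some $r$, with $D_{ij}=\|p_i-p_j\|_2^2$ for all $i,j$ (squared distances); the smallest such $r$ is the embedding dimension of $D$. $\mathcal E^n$ is the set of $n\times n$ EDMs. The embedding dimension $r$ is given and fixed. Only some entries of $D$ are known, and the EDM completion problem consists of finding the missing entries. Nodes are the indices $1,\dots,n$. For an index set $\alpha$, $D[\alpha]$ is the principal submatrix of $D$ with rows and columns indexed by $\alpha$. A clique is a set of indices $\alpha\subseteq\{1,\dots,n\}$ such that all entries of $D[\alpha]$ are known. $\{C_i\}_{i\in\mathcal C}$ is a family of cliques indexed by a finite set $\mathcal C$ of positive integers. That a node $l$ is absorbed by a clique $C_k$ means that the clique $C_k$ is grown to the clique $C_k\cup\{l\}$. The operator $\mathcal K^\dagger$ on real symmetric $m\times m$ matrices is $\mathcal K^\dagger(D)=-\frac12J\,\mathrm{offDiag}(D)\,J$, where $J=I-\frac1m ee^T$, $e\in\mathbb R^m$ is the all-ones vector, and $\mathrm{offDiag}(D)$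 is $D$ with its diagonal replaced by zeros. It is the generalized inverse of the linear operator $\mathcal K(Y)=\operatorname{diag}(Y)e^T+e\operatorname{diag}(Y)^T-2Y$, where $\operatorname{diag}(Y)$ is the vector of diagonal entries of $Y$. *)

(* Defs.v *)
From mathcomp Require Import all_boot all_order all_algebra.
From mathcomp Require Import reals.

Set Implicit Arguments.
Unset Strict Implicit.
Unset Printing Implicit Defensive.

Import GRing.Theory Num.Theory.
Local Open Scope ring_scope.

(* The squared Euclidean norm; MathComp-Analysis norms matrices by sup. *)
Definition sqnorm (R : realType) (r : nat) (v : 'rV[R]_r) : R :=
  \sum_(k < r) v 0 k ^+ 2.

Definition realizable (R : realType) (n : nat) (D : 'M[R]_n) (r : nat) : Prop :=
  exists p : 'I_n -> 'rV[R]_r, forall i j, D i j = sqnorm (p i - p j).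

Definition is_edm (R : realType) (n : nat) (D : 'M[R]_n) : Prop :=
  D^T = D /\ exists r, realizable D r.

Definition embedding_dim (R : realType) (n : nat) (D : 'M[R]_n) (r : nat) : Prop :=
  realizable D r /\ forall s, realizable D s -> (r <= s)%N.

(* D[alpha], the elements of alpha being listed in increasing order. *)
Definition psubmx (R : realType) (n : nat) (alpha : {set 'I_n}) (D : 'M[R]_n) :
    'M[R]_#|alpha| :=
  \matrix_(i, j) D (enum_val i) (enum_val j).

Definition off_diag (R : realType) (m : nat) (D : 'M[R]_m) : 'M[R]_m :=
  \matrix_(i, j) (if i == j then 0 else D i j).

Definition ones (R : realType) (m : nat) : 'cV[R]_m := const_mx 1.

Definition centering (R : realType) (m : nat) : 'M[R]_m :=
  1%:M - m%:R^-1 *: (ones R m *m (ones R m)^T).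

Definition Kdagger (R : realType) (m : nat) (D : 'M[R]_m) : 'M[R]_m :=
  - 2%:R^-1 *: (centering R m *m off_diag D *m centering R m).

(* A partial matrix is given by a full matrix D together with a relation
   [known i j], meaning that the entry D i j is available. *)
Definition clique (n : nat) (known : 'I_n -> 'I_n -> Prop) (alpha : {set 'I_n}) :
    Prop :=
  forall i j, i \in alpha -> j \in alpha -> known i j.

Definition known_in (n : nat) (known : 'I_n -> 'I_n -> Prop)
    (alpha : {set 'I_n}) : 'I_#|alpha| -> 'I_#|alpha| -> Prop :=
  fun i j => known (enum_val i) (enum_val j).

(* X solves the EDM completion problem in embedding dimension r; this depends
   on D only through its known entries. *)
Definition edm_completion (R : realType) (n : nat)
    (known : 'I_n -> 'I_n -> Prop) (D : 'M[R]_n) (r : nat) (X : 'M[R]_n) : Prop :=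
  [/\ is_edm X, embedding_dim X r & forall i j, known i j -> X i j = D i j].

(* The known entries and the dimension r force the value of entry (i, j);
   every known entry is determined. *)
Definition determined (R : realType) (n : nat)
    (known : 'I_n -> 'I_n -> Prop) (D : 'M[R]_n) (r : nat) (i j : 'I_n) : Prop :=
  forall X, edm_completion known D r X -> X i j = D i j.

(* C grows to the clique l |: C once the entries forced by the known ones are
   filled in. *)
Definition absorbs (R : realType) (n : nat)
    (known : 'I_n -> 'I_n -> Prop) (D : 'M[R]_n) (r : nat)
    (C : {set 'I_n}) (l : 'I_n) : Prop :=
  clique (determined known D r) (l |: C).

(* The partial matrix D[alpha] on its own, using none of the known entries
   outside alpha, has D[alpha] as its only completion. *)
Definition completable (R : realType) (n : nat)
    (known : 'I_n -> 'I_n -> Prop) (D : 'M[R]_n) (r : nat)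
    (alpha : {set 'I_n}) : Prop :=
  forall X : 'M[R]_#|alpha|,
    edm_completion (known_in known (alpha := alpha)) (psubmx alpha D) r X
    <-> X = psubmx alpha D.

(* Main.v *)
Require Import Defs.
From mathcomp Require Import all_boot all_order all_algebra.
From mathcomp Require Import reals.
From mathcomp Require Import ring.

(** Since [beta] consists of points of a configuration in dimension [r] whose
    centred Gram matrix [Kdagger D[beta]] has rank [r], these points affinely
    span the whole space, and a point of an [r]-dimensional space is located by
    its distances to an affinely spanning family.

    To make this precise without locating anything, compare two configurations
    [p] and [q] in dimension [r] after translating one common anchor of [beta]
    to the origin.  By the law of cosines, equal distances give equal inner
    products, so if [A] and [B] are the matrices whose rows are the translated
    anchors, then [A A^T = B B^T], and a point [x] whose distances to the
    anchors agree in both configurations satisfies [x_p A^T = x_q B^T].  As [A]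
    has a left inverse, an orthogonal matrix carries all such [x_q] to [x_p]
    at once ([mulmx_tr_rigid]); hence the distance between any two of them is
    the same in both configurations ([realizable_rigid]).  Every element of
    [l |: C] has known distances to [beta]: the elements of [C] because [C] is
    a clique containing [beta], and [l] by assumption.

    The rank hypothesis enters through [rank_Kdagger_le]: the rank of
    [Kdagger] of a distance matrix is at most that of any coordinate matrix of
    the points.  This yields both the left inverse of [A] and the fact that
    [D[l |: C]] still has embedding dimension exactly [r]. *)

Set Implicit Arguments.
Unset Strict Implicit.
Unset Printing Implicit Defensive.

Import GRing.Theory Num.Theory.
Local Open Scope ring_scope.

Lemma dotmxE (R : pzSemiRingType) r (u v : 'rV[R]_r) i j :
  (u *m v^T) i j = \sum_k u 0 k * v 0 k.
Proof.
by rewrite mxE; apply: eq_bigr => k _; rewrite mxE !ord1.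
Qed.

Lemma row_mulmx_tr (R : pzSemiRingType) m n r (A : 'M[R]_(m, r))
    (B : 'M[R]_(n, r)) i j :
  (A *m B^T) i j = (row i A *m (row j B)^T) 0 0.
Proof.
by rewrite dotmxE mxE; apply: eq_bigr => k _; rewrite !mxE.
Qed.

(** The law of cosines. *)
Lemma sqnormB (R : realType) r (u v : 'rV[R]_r) :
  sqnorm (u - v) = sqnorm u + sqnorm v - 2 * (u *m v^T) 0 0.
Proof.
rewrite dotmxE /sqnorm mulr_sumr -big_split -sumrB /=.
by apply: eq_bigr => k _; rewrite !mxE; ring.
Qed.

Lemma dotmx_polar (R : realType) r (u v : 'rV[R]_r) :
  (u *m v^T) 0 0 = 2^-1 * (sqnorm u + sqnorm v - sqnorm (u - v)).
Proof. by rewrite sqnormB; field. Qed.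

Lemma sqnorm0 (R : realType) r : sqnorm (0 : 'rV[R]_r) = 0.
Proof. by rewrite /sqnorm big1 // => k _; rewrite mxE expr0n. Qed.

(** If [L] is a left inverse of [A], then [V = (L B)^T] is orthogonal, because
    [L B B^T L^T = L A A^T L^T = 1], and it sends every [w'] with
    [w A^T = w' B^T] to [w]; [V] is the same for all vectors, so it preserves
    their mutual inner products. *)
Lemma mulmx_tr_rigid (F : fieldType) m r s t (A B : 'M[F]_(m, r))
    (u u' : 'M[F]_(s, r)) (v v' : 'M[F]_(t, r)) :
  row_full A -> A *m A^T = B *m B^T ->
  u *m A^T = u' *m B^T -> v *m A^T = v' *m B^T ->
  u *m v^T = u' *m v'^T.
Proof.
move=> /row_fullP[L LA] AB uA vA.
have trLA : A^T *m L^T = 1%:M by rewrite -trmx_mul LA trmx1.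
pose V := B^T *m L^T.
have VV : V *m V^T = 1%:M.
  apply: mulmx1C.
  by rewrite /V trmx_mul !trmxK mulmxA -(mulmxA L) -AB !mulmxA LA mul1mx.
have toV k (w w' : 'M_(k, r)) : w *m A^T = w' *m B^T -> w = w' *m V.
  by move=> wA; rewrite /V mulmxA -wA -mulmxA trLA mulmx1.
by rewrite (toV _ _ _ uA) (toV _ _ _ vA) trmx_mul mulmxA -(mulmxA u') VV mulmx1.
Qed.

Lemma trmx_centering (R : realType) m : (centering R m)^T = centering R m.
Proof. by rewrite /centering linearB linearZ /= trmx1 trmx_mul trmxK. Qed.

Lemma centering_ones (R : realType) m : centering R m *m ones R m = 0.
Proof.
case: m => [|m]; first exact: flatmx0.
rewrite /centering mulmxBl mul1mx -scalemxAl -mulmxA.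
have -> : (ones R m.+1)^T *m ones R m.+1 = m.+1%:R%:M.
  apply/matrixP=> i j; rewrite !ord1 !mxE.
  by under eq_bigr do rewrite !mxE mul1r; rewrite sumr_const card_ord.
by rewrite mul_mx_scalar scalerA mulVf ?pnatr_eq0 // scale1r subrr.
Qed.

(** Expanding by the law of cosines, the squared lengths of the points
    contribute terms of the form [g 1^T] and [1 g^T], which centring kills;
    there remains the Gram matrix of the centred points. *)
Lemma Kdagger_dist (R : realType) m s (P : 'M[R]_(m, s)) :
  Kdagger (\matrix_(i, j) sqnorm (row i P - row j P)) =
  centering R m *m P *m (centering R m *m P)^T.
Proof.
pose g : 'cV[R]_m := \col_i sqnorm (row i P).
set D := \matrix_(i, j) _.
have -> : Kdagger D = - 2^-1 *: (centering R m *m D *m centering R m).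
  congr (_ *: (_ *m _ *m _)); apply/matrixP=> i j; rewrite !mxE.
  by case: eqP => // ->; rewrite subrr sqnorm0.
have -> : D = g *m (ones R m)^T + ones R m *m g^T - 2 *: (P *m P^T).
  apply/matrixP=> i j.
  rewrite mxE sqnormB -row_mulmx_tr; move: (P *m P^T) => G.
  by rewrite !mxE !big_ord1 !mxE mulr1 mul1r.
(* Abstracting [J] keeps [mulmxBr] from distributing over the difference
   that defines it. *)
move: (centering R m) (centering_ones R m) (trmx_centering R m) => J J1 trJ.
have onesJ : (ones R m)^T *m J = 0 by rewrite -trJ -trmx_mul J1 trmx0.
rewrite mulmxBr mulmxDr mulmxBl mulmxDl !mulmxA J1 !mul0mx addr0.
rewrite -[_ *m g *m _ *m _]mulmxA onesJ mulmx0 sub0r.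
rewrite -scalemxAr -scalemxAl -scalerN scalerA scalerN.
rewrite mulNr mulVf ?pnatr_eq0 //.
by rewrite scaleN1r opprK trmx_mul trJ !mulmxA.
Qed.

Lemma rank_Kdagger_le (R : realType) m s (P : 'M[R]_(m, s)) :
  (\rank (Kdagger (\matrix_(i, j) sqnorm (row i P - row j P))) <= \rank P)%N.
Proof.
by rewrite Kdagger_dist (leq_trans (mxrankM_maxl _ _)) ?mxrankM_maxr.
Qed.

(** Translating the anchor [b ord0] to the origin turns the equalities of
    distances into equalities of inner products, and the rank condition into
    the statement that the other anchors span the space linearly, which are
    the hypotheses of [mulmx_tr_rigid]. *)
Lemma realizable_rigid (R : realType) n m r (D X : 'M[R]_n)
    (b : 'I_m.+1 -> 'I_n) (x y : 'I_n) :
  realizable D r -> realizable X r ->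
  \rank (Kdagger (mxsub b b D)) = r ->
  (forall i j, X (b i) (b j) = D (b i) (b j)) ->
  (forall i, X x (b i) = D x (b i)) ->
  (forall i, X y (b i) = D y (b i)) ->
  X x y = D x y.
Proof.
move=> [p Dp] [q Xq] rkD Xbb Xxb Xyb.
pose P z := p z - p (b ord0); pose Q z := q z - q (b ord0).
have PB z t : P z - P t = p z - p t by rewrite /P opprB addrA subrK.
have QB z t : Q z - Q t = q z - q t by rewrite /Q opprB addrA subrK.
pose A := \matrix_i P (b i); pose B := \matrix_i Q (b i).
have normPQ z : X z (b ord0) = D z (b ord0) -> sqnorm (P z) = sqnorm (Q z).
  by rewrite Dp Xq.
have dotPQ z t : X z (b ord0) = D z (b ord0) -> X t (b ord0) = D t (b ord0) ->
    X z t = D z t -> (P z *m (P t)^T) 0 0 = (Q z *m (Q t)^T) 0 0.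
  by move=> Xz Xt Xzt; rewrite !dotmx_polar !normPQ // PB QB -Dp -Xq Xzt.
have fullA : row_full A.
  rewrite /row_full eqn_leq rank_leq_col -{1}rkD.
  suff -> : mxsub b b D = \matrix_(i, j) sqnorm (row i A - row j A).
    exact: rank_Kdagger_le.
  by apply/matrixP=> i j; rewrite !mxE !rowK PB Dp.
have AB : A *m A^T = B *m B^T.
  apply/matrixP=> i j; rewrite row_mulmx_tr [RHS]row_mulmx_tr !rowK.
  exact: dotPQ.
have anchored z : (forall i, X z (b i) = D z (b i)) ->
    P z *m A^T = Q z *m B^T.
  move=> Xz; apply/matrixP=> i j; rewrite row_mulmx_tr [RHS]row_mulmx_tr !rowK.
  by rewrite !row_id; apply: dotPQ.
have PQ := mulmx_tr_rigid fullA AB (anchored _ Xxb) (anchored _ Xyb).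
by rewrite Dp Xq -PB -QB (sqnormB (P x)) (sqnormB (Q x)) PQ !normPQ.
Qed.

Lemma realizable_mxsub (R : realType) n m r (f : 'I_m -> 'I_n) (D : 'M[R]_n) :
  realizable D r -> realizable (mxsub f f D) r.
Proof. by case=> p Dp; exists (p \o f) => i j; rewrite mxE Dp. Qed.

Lemma realizable_edm (R : realType) n r (D : 'M[R]_n) :
  realizable D r -> is_edm D.
Proof.
move=> Dr; split; last by exists r.
case: Dr => p Dp; apply/matrixP=> i j; rewrite mxE !Dp -opprB.
by apply: eq_bigr => k _; rewrite mxE sqrrN.
Qed.

(** Only configurations in dimension at least [\rank (Kdagger D)] have distance
    matrix [D]; this bounds from below the embedding dimension of any matrix
    containing [D] as a principal submatrix. *)
Lemma rank_Kdagger_realizable (R : realType) n s (D : 'M[R]_n) :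
  realizable D s -> (\rank (Kdagger D) <= s)%N.
Proof.
case=> p Dp; apply: leq_trans (rank_leq_col (\matrix_i p i)).
suff {1}-> : D = \matrix_(i, j) sqnorm (row i (\matrix_i p i)
                                       - row j (\matrix_i p i)).
  exact: rank_Kdagger_le.
by apply/matrixP=> i j; rewrite mxE !rowK Dp.
Qed.

Theorem corollary2p17 (R : realType) (n r : nat) (D : 'M[R]_n)
    (known : 'I_n -> 'I_n -> Prop) (C : {set 'I_n}) (l : 'I_n)
    (beta : {set 'I_n})
    (D_edm : is_edm D) (D_dim : embedding_dim D r)
    (C_clique : clique known C) (l_notin_C : l \notin C)
    (beta_sub_C : beta \subset C) (card_beta : #|beta| = r.+1)
    (known_l_beta : forall j, j \in beta -> known l j)
    (rank_beta : \rank (Kdagger (psubmx beta D)) = r) :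
  absorbs known D r C l /\ completable known D r (l |: C).
Proof.
have [Dr _] := D_dim.
have known_beta x j : x \in l |: C -> j \in beta -> known x j.
  case/setU1P=> [-> | xC] jb; first exact: known_l_beta.
  exact: C_clique (subsetP beta_sub_C _ jb).
have beta_sub j : j \in beta -> j \in l |: C.
  by move=> jb; rewrite setU1r // (subsetP beta_sub_C).
have [b [b_beta rank_b]] : exists b : 'I_r.+1 -> 'I_n,
    (forall i, b i \in beta) /\ \rank (Kdagger (mxsub b b D)) = r.
  by rewrite -card_beta; exists enum_val; split=> //; apply: enum_valP.
split.
  move=> x y xlC ylC X [_ [Xr _] Xknown].
  by apply: (realizable_rigid Dr Xr rank_b) => *;
    apply/Xknown/known_beta => //; apply: beta_sub.
move=> X; set alpha := l |: C in X *.
have Dar : realizable (psubmx alpha D) r := realizable_mxsub enum_val Dr.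
pose b' i := enum_rank_in (setU11 l C) (b i).
have b'K i : enum_val (b' i) = b i by apply/enum_rankK_in/beta_sub.
have rank_b' : \rank (Kdagger (mxsub b' b' (psubmx alpha D))) = r.
  rewrite -[RHS]rank_b; congr (\rank (Kdagger _)).
  by apply/matrixP=> i j; rewrite !mxE !b'K.
have known_b' x i : known_in known x (b' i).
  by rewrite /known_in b'K; apply: known_beta => //; apply: enum_valP.
split=> [[_ [Xr _] Xknown] | ->].
  apply/matrixP=> x y.
  by apply: (realizable_rigid Dar Xr rank_b') => *; apply: Xknown.
split=> //; first exact: realizable_edm Dar.
split=> // s /(realizable_mxsub b') /rank_Kdagger_realizable.
by rewrite rank_b'.
Qed.
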